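(* Let $k$ be an odd positive integer and let $c_2\leq c_3$ be positive integers. Then the petal graph $P_{1,c_2,c_3}$ can be embedded in $K_k^*$ if and only if $c_2\geq3$ and $1+c_2+c_3\leq\binom{k+1}{2}$.
   Context: $K_k^*$ denotes the complete graph $K_k$ on vertices $v_0,\dotsc,v_{k-1}$ with a loop $v_iv_i$ added at every vertex. An embedding of a graph $G$ (simple graph possibly with at most one loop per vertex) in $K_k^*$ is a map $f:V(G)\to V(K_k^* )$ such that each edge $uv$ of $G$ is sent to the edge $f(u)f(v)$ of $K_k^*$ (a loop if $f(u)=f(v)$), and the induced map $E(G)\to E(K_k^* )$ is injective. For positive integers $c_1\leq c_2\leq\dotsb\leq c_m$ ($m\geq2$), the petal graph $P_{c_1,\dotsc,c_m}$ has a central vertex $u_0$ and, for each $i$, vertices $u^i_1,\dotsc,u^i_{c_i-1}$ forming a cycle $u_0u^i_1\dotsb u^i_{c_i-1}u_0$ of length $c_i$ (the $i$-th petal); if $c_i=1$ the $i$-th petal is a loop at $u_0$. Thus $P_{1,c_2,c_3}$ is a loop at $u_0$ together with two cycles of lengths $c_2,c_3$ through $u_0$, and has $1+c_2+c_3$ edges. *)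

(* Defs.v *)
From mathcomp Require Import all_boot.
Set Implicit Arguments.
Unset Strict Implicit.
Unset Printing Implicit Defensive.

(* Finite multigraphs: edges form a type of their own, so parallel edges and
   several loops at one vertex are allowed.  A loop is an edge whose set of
   ends is a singleton. *)
Record mgraph := MGraph {
  vertex : finType;
  edge : finType;
  ends : edge -> {set vertex};
  ends_card : forall e : edge, 0 < #|ends e| <= 2
}.

(* [f] need not be injective on vertices.  When distinct edges of [H] have
   distinct ends, as in [looped_complete k], [phi] is determined by [f]: it is
   the induced map on edges. *)
Definition embedding (G H : mgraph) (f : vertex G -> vertex H) : Prop :=
  exists phi : edge G -> edge H,
    (forall e : edge G, ends (phi e) = f @: ends e) /\ injective phi.

Definition embeddable (G H : mgraph) : Prop :=
  exists f : vertex G -> vertex H, embedding f.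

Section LoopedComplete.
Variable k : nat.

Definition looped_complete_edge : finType :=
  {e : {set 'I_k} | 0 < #|e| <= 2}.

Definition looped_complete : mgraph :=
  @MGraph 'I_k looped_complete_edge val (fun e => valP e).

End LoopedComplete.

(* Petal lengths are c = [:: c_1; ...; c_m], indexed from 0.  A petal of
   length 1 is a loop and a petal of length 2 is a pair of parallel edges, so
   there are always c_1 + ... + c_m edges. *)
Section Petal.
Variable c : seq nat.

Definition petal_len (i : 'I_(size c)) : nat := nth 0 c i.

(* [None] is the central vertex u_0; the pair (i, j) is u^i_(j+1). *)
Definition petal_vertex : finType :=
  option {i : 'I_(size c) & 'I_(petal_len i).-1}.

(* The j-th vertex along the i-th petal, for 0 <= j <= petal_len i: both
   j = 0 and j = petal_len i give the central vertex. *)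
Definition petal_at (i : 'I_(size c)) (j : nat) : petal_vertex :=
  if j is j'.+1 then
    omap (Tagged (fun i : 'I_(size c) => 'I_(petal_len i).-1))
         (insub j' : option 'I_(petal_len i).-1)
  else None.

Definition petal_edge : finType :=
  {i : 'I_(size c) & 'I_(petal_len i)}.

Definition petal_ends (e : petal_edge) : {set petal_vertex} :=
  [set petal_at (tag e) (tagged e); petal_at (tag e) (tagged e).+1].

Lemma petal_ends_card (e : petal_edge) : 0 < #|petal_ends e| <= 2.
Proof. by rewrite /petal_ends cards2; case: eqP. Qed.

Definition petal_graph : mgraph := MGraph petal_ends_card.

End Petal.

(* Main.v *)
(* Necessity: a petal of length 1 or 2 would repeat an edge, and the number of
   edges gives the bound.

   Sufficiency: one needs two edge-disjoint closed trails of lengths a and b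
   through 0 that avoid the loop at 0.  They are built by induction from k to
   k + 2.  The edges at the two new vertices x and y split into the triangle
   0xy, two loops and 4-cycles x v y w, so they carry closed trails at 0 of every
   length d with 3 <= d <= 2k + 3.  Appending one to the longer trail reduces
   (a, b) to (a, b - d).  This fails only for a few pairs in K_5 and K_7, which
   are given explicitly. *)
Require Import Defs.
From mathcomp Require Import all_boot zify.
Set Implicit Arguments.
Unset Strict Implicit.
Unset Printing Implicit Defensive.

(** * Embeddings via end sets, and edge counts *)

(** An edge of [looped_complete k] is its set of ends, and the image of a nonempty set of at most
    two vertices is again such a set, so only injectivity is left to check. *)
Lemma embedding_looped_complete (G : mgraph) (k : nat)
    (f : vertex G -> vertex (looped_complete k)) :
  embedding f <-> injective (fun e : edge G => f @: ends e).
Proof.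
split=> [[phi [phiE phi_inj]] e e' /= fe | f_inj].
  have ends_eq : ends (phi e) = ends (phi e') by rewrite !phiE.
  exact/phi_inj/val_inj.
have fe_card (e : edge G) : 0 < #|f @: ends e| <= 2.
  have /andP[e_gt0 e_le2] := ends_card e.
  rewrite (leq_trans (leq_imset_card _ _) e_le2) andbT.
  have /card_gt0P[x xe] := e_gt0.
  by apply/card_gt0P; exists (f x); apply: imset_f.
exists (fun e => Sub (f @: ends e) (fe_card e)); split=> // e e' /(congr1 val).
exact: f_inj.
Qed.

Lemma card_looped_complete_edge (k : nat) :
  #|looped_complete_edge k| = 'C(k.+1, 2).
Proof.
rewrite card_sub -[LHS]cardsE binS bin1.
have -> : [set e : {set 'I_k} | 0 < #|e| <= 2] =
    [set e : {set 'I_k} | #|e| == 1] :|: [set e : {set 'I_k} | #|e| == 2].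
  by apply/setP=> e; rewrite !inE; case: #|e| => [|[|[|]]].
rewrite cardsU !card_draws card_ord bin1 -[RHS]subn0 addnC; congr (_ - _).
apply/eqP; rewrite cards_eq0 -subset0; apply/subsetP=> e.
by rewrite !inE => /andP[/eqP->].
Qed.

Lemma card_petal_edge (c : seq nat) : #|petal_edge c| = sumn c.
Proof.
rewrite card_tagged !sumnE big_map big_enum [RHS](big_nth 0) big_mkord /=.
by apply: eq_bigr => i _; rewrite card_ord.
Qed.

Lemma embeddable_card_edge (G H : mgraph) :
  embeddable G H -> #|edge G| <= #|edge H|.
Proof. by case=> f [phi [_ phi_inj]]; apply: leq_card phi_inj. Qed.

(** * Closed trails and the embeddings they give *)

(* The walk [x :: w]; an edge [uv] with [u <= v] is encoded as [(u, v)]. *)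
Definition walk_edges (x : nat) (w : seq nat) : seq (nat * nat) :=
  pairmap (fun u v => (minn u v, maxn u v)) x w.

Lemma walk_edges_cat (x : nat) (w1 w2 : seq nat) :
  walk_edges x (w1 ++ w2) = walk_edges x w1 ++ walk_edges (last x w1) w2.
Proof. exact: pairmap_cat. Qed.

Lemma walk_edges_lt (k x : nat) (w : seq nat) :
  all (gtn k) (x :: w) -> all (fun e => e.2 < k) (walk_edges x w).
Proof.
elim: w x => //= y w IHw x /and3P[x_lt y_lt w_lt].
by rewrite IHw /= ?y_lt // andbT; lia.
Qed.

(* All trails are based at 0, and [ws] omits this starting point. *)
Definition closed_trails (k : nat) (ws : seq (seq nat)) : bool :=
  [&& all (all (gtn k)) ws, all (fun w => last 0 w == 0) ws
    & uniq (flatten [seq walk_edges 0 w | w <- ws])].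

Lemma uniq_flatten_nth_inj (T : eqType) (x0 : T) (ss : seq (seq T))
    (i i' j j' : nat) :
  uniq (flatten ss) -> j < size (nth [::] ss i) -> j' < size (nth [::] ss i') ->
  nth x0 (nth [::] ss i) j = nth x0 (nth [::] ss i') j' -> i = i' /\ j = j'.
Proof.
elim: ss i i' => [|s ss IHss] i i' /=; first by rewrite nth_nil.
rewrite cat_uniq => /and3P[s_uniq /hasPn disj ss_uniq].
have notin l l' p : l < size (nth [::] ss p) -> l' < size s ->
    nth x0 (nth [::] ss p) l <> nth x0 s l'.
  move=> l_lt l'_lt eq_nth.
  have p_lt : p < size ss.
    by rewrite ltnNge; apply: contraL l_lt => ?; rewrite nth_default.
  have /disj : nth x0 (nth [::] ss p) l \in flatten ss.
    by apply/flattenP; exists (nth [::] ss p); rewrite mem_nth.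
  by rewrite eq_nth mem_nth.
case: i i' => [|i] [|i'] /= j_lt j'_lt.
- by move/eqP; rewrite nth_uniq // => /eqP.
- by move/esym/notin => /(_ j'_lt j_lt).
- by move/notin => /(_ j_lt j'_lt).
- by case/IHss => // -> ->.
Qed.

Lemma set2_minn_maxn_inj (k : nat) (x y x' y' : 'I_k) :
  [set x; y] = [set x'; y'] ->
  (minn x y, maxn x y) = (minn x' y', maxn x' y').
Proof.
move=> eq_set.
have := set21 x y; have := set22 x y; rewrite eq_set !inE -!val_eqE /= => xy yx.
have := set21 x' y'; have := set22 x' y'; rewrite -eq_set !inE -!val_eqE /= => *.
by apply/eqP; rewrite xpair_eqE; lia.
Qed.

(** Each petal is wrapped around its trail: edge [(i, j)] goes to the j-th edge of the i-th trail,
    and [uniq] of the flattened list makes this injective. *)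
Lemma closed_trails_embeddable (k : nat) (ws : seq (seq nat)) :
  0 < k -> closed_trails k ws ->
  embeddable (petal_graph (map size ws)) (looped_complete k).
Proof.
case: k => // k _ /and3P[/allP ws_lt /allP ws_closed ws_uniq].
pose c := map size ws.
pose f (u : petal_vertex c) : 'I_k.+1 :=
  if u is Some (existT i j) then inord (nth 0 (nth [::] ws i) j) else ord0.
have ws_mem (i : 'I_(size c)) : nth [::] ws i \in ws.
  by rewrite mem_nth // -(size_map size).
have petal_lenE (i : 'I_(size c)) : petal_len i = size (nth [::] ws i).
  by rewrite /petal_len (nth_map [::]) // -(size_map size).
have f_at (i : 'I_(size c)) j : j <= petal_len i ->
    f (petal_at i j) = nth 0 (0 :: nth [::] ws i) j :> nat.
  case: j => // j j_lt; rewrite /petal_at.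
  case: insubP => [j' _ /= j'E | /=].
    rewrite j'E inordK //; apply: (allP (ws_lt _ (ws_mem i))).
    by rewrite mem_nth // -petal_lenE.
  (* Here [insub] fails: the petal is back at the centre, which [f] sends to 0, and the trail is at
     its last vertex, also 0. *)
  move=> j_ge; rewrite petal_lenE in j_lt j_ge.
  have -> : j = (size (nth [::] ws i)).-1 by lia.
  by rewrite nth_last; apply/esym/eqP/ws_closed/ws_mem.
have edgeE (i : 'I_(size c)) (j : 'I_(petal_len i)) :
    (minn (f (petal_at i j)) (f (petal_at i j.+1)),
     maxn (f (petal_at i j)) (f (petal_at i j.+1))) =
    nth (0, 0) (nth [::] [seq walk_edges 0 w | w <- ws] i) j.
  rewrite !f_at ?(ltnW (ltn_ord _)) //.
  rewrite (nth_map [::]) -?(size_map size) // (nth_pairmap 0) //.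
  by rewrite -petal_lenE.
exists f; apply/embedding_looped_complete => -[i j] [i' j'].
rewrite /= /petal_ends !imsetU1 !imset_set1 => /set2_minn_maxn_inj eq_edge.
have {eq_edge} := etrans (esym (edgeE i j)) (etrans eq_edge (edgeE i' j')).
move/uniq_flatten_nth_inj.
rewrite !(nth_map [::]) -?(size_map size) // !size_pairmap -!petal_lenE.
move=> /(_ ws_uniq (ltn_ord _) (ltn_ord _)) [/val_inj eq_i].
by case: i' / eq_i j' => j' /val_inj ->.
Qed.

(** * Detours through two new vertices *)

(* Each step is a 4-cycle from [k] through [m], [k.+1] and [m.+1]. *)
Fixpoint zigzag (k m j : nat) : seq nat :=
  if j is j'.+1 then [:: m, k.+1, m.+1, k & zigzag k m.+2 j'] else [::].

Lemma size_zigzag (k m j : nat) : size (zigzag k m j) = 4 * j.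
Proof. by elim: j m => //= j IHj m; rewrite IHj; lia. Qed.

Lemma last_zigzag (k m j : nat) : last k (zigzag k m j) = k.
Proof. by elim: j m => //=. Qed.

Lemma zigzag_lt (k m j : nat) :
  m + j.*2 <= k -> all (gtn k.+2) (zigzag k m j).
Proof.
elim: j m => //= j IHj m mj_le; rewrite IHj; lia.
Qed.

(** The interval of smaller ends separates successive 4-cycles from each other, and the zigzag from
    the rest of a detour. *)
Lemma zigzag_edges_range (k m j : nat) : m + j.*2 <= k ->
  all (fun e => (m <= e.1 < m + j.*2) && (k <= e.2))
      (walk_edges k (zigzag k m j)).
Proof.
elim: j m => //= j IHj m mj_le; rewrite (sub_all _ (IHj _ _)); try lia.
by move=> e /=; lia.
Qed.

Lemma zigzag_edges_uniq (k m j : nat) : m + j.*2 <= k ->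
  uniq (walk_edges k (zigzag k m j)).
Proof.
elim: j m => // j IHj m mj_le.
have tl_range : m.+2 + j.*2 <= k by lia.
rewrite -[zigzag _ _ _]/([:: m; k.+1; m.+1; k] ++ zigzag k m.+2 j).
rewrite walk_edges_cat cat_uniq IHj // andbT; apply/andP; split.
  by rewrite /= !inE !xpair_eqE; lia.
apply/hasPn=> e /(allP (zigzag_edges_range tl_range)).
by case: e => e1 e2; rewrite /= !inE !xpair_eqE; lia.
Qed.

(** The zigzag is closed at [k], so it can be spliced between a walk [A] from 0 to [k] and a walk
    [B] back to 0. *)
Lemma detour_via_zigzag (k m j : nat) (A B : seq nat) :
  m + j.*2 <= k -> last 0 A = k -> last k B = 0 -> all (gtn k.+2) (A ++ B) ->
  uniq (walk_edges 0 A ++ walk_edges k B) ->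
  all (fun e => ~~ (m <= e.1 < m + j.*2) && (k <= e.2))
      (walk_edges 0 A ++ walk_edges k B) ->
  exists w, [/\ size w = size (A ++ B) + 4 * j, all (gtn k.+2) w, last 0 w = 0,
    uniq (walk_edges 0 w) & all (fun e => k <= e.2) (walk_edges 0 w)].
Proof.
move=> mj_le lastA lastB; rewrite all_cat => /andP[A_lt B_lt] AB_uniq AB_range.
have /allP zz_range := zigzag_edges_range mj_le.
exists (A ++ zigzag k m j ++ B).
rewrite !walk_edges_cat lastA last_zigzag; split.
- by rewrite !size_cat size_zigzag; lia.
- by rewrite !all_cat A_lt zigzag_lt.
- by rewrite !last_cat lastA last_zigzag.
- rewrite uniq_catCA cat_uniq zigzag_edges_uniq // AB_uniq andbT.
  apply/hasPn=> e /(allP AB_range) /andP[/negP e_out _].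
  by apply/negP=> /zz_range /andP[].
- rewrite all_cat in AB_range; have /andP[A_range B_range] := AB_range.
  rewrite !all_cat (sub_all _ A_range) ?(sub_all _ B_range) ?andbT //.
  + by apply/allP=> e /zz_range /andP[].
  + by move=> e /andP[].
  + by move=> e /andP[].
Qed.

Lemma detour (n d : nat) (k := n.*2.+1) : 3 <= d <= 2 * k + 3 ->
  exists w, [/\ size w = d, all (gtn k.+2) w, last 0 w = 0,
    uniq (walk_edges 0 w) & all (fun e => k <= e.2) (walk_edges 0 w)].
Proof.
move=> d_range; pose j := (d - 3) %/ 4.
(* The triangle on 0, k and k.+1 with at most two loops reaches every residue of
   d modulo 4 but 2; for that one the triangle is replaced by a 4-cycle. *)
have [r r_lt dE] : exists2 r, r < 4 & d = r + 3 + 4 * j.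
  by exists ((d - 3) %% 4); lia.
case: r r_lt dE => [|[|[|[|//]]]] _ dE.
- have [||||||w] := @detour_via_zigzag k 1 j [:: k] [:: k.+1; 0];
    try (rewrite /= ?inE ?negb_or ?xpair_eqE //; repeat (apply/andP; split); lia).
  by case=> /= size_w *; exists w; split=> //; lia.
- have [||||||w] := @detour_via_zigzag k 1 j [:: k; k] [:: k.+1; 0];
    try (rewrite /= ?inE ?negb_or ?xpair_eqE //; repeat (apply/andP; split); lia).
  by case=> /= size_w *; exists w; split=> //; lia.
- have [||||||w] := @detour_via_zigzag k 1 j [:: k; k] [:: k.+1; k.+1; 0];
    try (rewrite /= ?inE ?negb_or ?xpair_eqE //; repeat (apply/andP; split); lia).
  by case=> /= size_w *; exists w; split=> //; lia.
- have [||||||w] := @detour_via_zigzag k 2 j [:: k; k] [:: 1; k.+1; k.+1; 0];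
    try (rewrite /= ?inE ?negb_or ?xpair_eqE //; repeat (apply/andP; split); lia).
  by case=> /= size_w *; exists w; split=> //; lia.
Qed.

(** * Pairs of edge-disjoint closed trails *)

(** The trail [[:: 0]] reserves the loop at 0 for the petal of length 1. *)
Definition has_trail_pair (k a b : nat) : Prop :=
  exists s t, [/\ size s = a, size t = b & closed_trails k [:: [:: 0]; s; t]].

Lemma closed_trails_pairE (k : nat) (s t : seq nat) :
  closed_trails k [:: [:: 0]; s; t] =
  [&& 0 < k, all (gtn k) (s ++ t), last 0 s == 0, last 0 t == 0
    & uniq ((0, 0) :: walk_edges 0 s ++ walk_edges 0 t)].
Proof. by rewrite /closed_trails /= all_cat cats0 !andbT -!andbA. Qed.

Lemma has_trail_pairC (k a b : nat) :
  has_trail_pair k a b -> has_trail_pair k b a.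
Proof.
case=> s [t [size_s size_t st]]; exists t, s; split=> //.
have ts_lt : all (gtn k) (t ++ s) = all (gtn k) (s ++ t).
  by rewrite !all_cat andbC.
have ts_uniq : uniq ((0, 0) :: walk_edges 0 t ++ walk_edges 0 s) =
    uniq ((0, 0) :: walk_edges 0 s ++ walk_edges 0 t).
  by apply: perm_uniq; rewrite perm_cons perm_catC.
move: st; rewrite !closed_trails_pairE ts_lt ts_uniq.
by case/and5P=> -> -> -> -> ->.
Qed.

Lemma has_trail_pair_le (k k' a b : nat) :
  k <= k' -> has_trail_pair k a b -> has_trail_pair k' a b.
Proof.
move=> k_le [s [t [size_s size_t]]]; rewrite closed_trails_pairE.
case/and3P=> k_gt0 st_lt st; exists s, t; split=> //.
rewrite closed_trails_pairE st (leq_trans k_gt0 k_le) (sub_all _ st_lt) //.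
by move=> x /= /leq_trans; apply.
Qed.

(** The larger end is at least [k] on the detour and below [k] on the old trails, so no edge
    repeats. *)
Lemma has_trail_pair_extend (n a b d : nat) (k := n.*2.+1) :
  3 <= d <= 2 * k + 3 -> has_trail_pair k a b -> has_trail_pair k.+2 a (b + d).
Proof.
case/detour=> w [size_w w_lt w_closed w_uniq w_new].
case=> s [t [size_s size_t]]; rewrite closed_trails_pairE.
case/and5P=> _ st_lt s_closed /eqP t_closed st_uniq.
exists s, (t ++ w); split; rewrite ?size_cat ?size_t ?size_w //.
rewrite closed_trails_pairE catA all_cat w_lt andbT last_cat t_closed w_closed.
rewrite s_closed walk_edges_cat t_closed catA -cat_cons cat_uniq st_uniq w_uniq.
rewrite (sub_all _ st_lt) ?andbT /=; last by move=> x /= /leqW /leqW.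
apply/hasPn=> e /(allP w_new) k_le; apply/negP=> e_old.
suff : e.2 < k by rewrite ltnNge k_le.
have st_edges :
    all (fun e => e.2 < k) ((0, 0) :: walk_edges 0 s ++ walk_edges 0 t).
  move: st_lt; rewrite /= !all_cat => /andP[s_lt t_lt].
  by rewrite !walk_edges_lt /= ?s_lt ?t_lt.
exact: (allP st_edges).
Qed.

(* Length 0, the trivial trail, is allowed to make the induction work. *)
Definition trail_length (a : nat) : bool := (a != 1) && (a != 2).

(** The bound is ['C(k.+1, 2) - 1] for [k = n.*2.+1]: every edge but the loop at 0 is available. *)
Lemma has_trail_pair_le_size (n a b : nat) :
  trail_length a -> trail_length b -> a + b <= n * (n.*2 + 3) ->
  has_trail_pair n.*2.+1 a b.
Proof.
elim: n a b => [|n IHn] a b a_len b_len ab_le.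
  by exists [::], [::]; split=> //=; lia.
wlog a_le_b : a b a_len b_len ab_le / a <= b => [wlog_le|].
  case: (leqP a b) => [|/ltnW b_le_a]; first exact: wlog_le.
  by apply/has_trail_pairC/wlog_le; rewrite // addnC.
(* Naming the bound keeps most of the arithmetic linear. It grows by [4 * n + 5], the number of
   edges at the two new vertices. *)
have [N NE] : exists N, N = n * (n.*2 + 3) by exists (n * (n.*2 + 3)).
have {}ab_le : a + b <= N + (4 * n + 5) by lia.
rewrite -NE in IHn.
have step d : 3 <= d <= minn b (4 * n + 5) -> trail_length (b - d) ->
    a + (b - d) <= N -> has_trail_pair n.+1.*2.+1 a b.
  move=> d_range bd_len abd_le; rewrite -(@subnK d b); last by lia.
  by apply: has_trail_pair_extend; [lia | exact: IHn].
have [small | ab_gt] := leqP (a + b) N.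
  by apply: has_trail_pair_le (IHn a b a_len b_len small); lia.
(* The shortest detour after which the rest fits in the smaller graph. *)
have [d dE] : exists d, d = maxn 3 (a + b - N) by exists (maxn 3 (a + b - N)).
have [d_le | b_lt] := leqP (d + 3) b.
  by apply: (step d); rewrite /trail_length; lia.
(* Failing that, the detour may be the whole longer trail, leaving length 0. *)
have [[b_le a_le] | no_detour] :
    (b <= 4 * n + 5 /\ a <= N) \/ ~ (b <= 4 * n + 5 /\ a <= N) by lia.
  by apply: (step b); move: b_len; rewrite /trail_length; lia.
(* If [n > 0], failure of both choices gives [N - 2 <= a <= b], hence [N <= 4 * n + 9], which is
   false from [n = 3] on. If [n = 0], then [a + b <= 5] forces [a = 0], and the second choice
   works. *)
have n_range : 0 < n < 3.
  move: a_len b_len; rewrite /trail_length.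
  have n_ge3 : n < 3 \/ N >= 4 * n + 11 by nia.
  case: n {IHn step} NE ab_le n_ge3 no_detour => [|n] *; lia.
have {n_range} [n1 | n2] : n = 1 \/ n = 2 by lia.
(* [n] indexes the smaller graph: [n = 1] is the case of K_5, [n = 2] that of K_7. *)
- subst n N.
  have : (a, b) \in
      [:: (6, 6); (6, 7); (6, 8); (7, 7); (3, 10); (3, 11); (4, 10)].
    by move: a_len b_len; rewrite /trail_length !inE !xpair_eqE; lia.
  rewrite !inE => /or4P[/eqP[-> ->]|/eqP[-> ->]|/eqP[-> ->]|].
  + by exists [:: 1; 1; 2; 2; 3; 0], [:: 2; 4; 1; 3; 4; 0].
  + by exists [:: 1; 1; 2; 2; 3; 0], [:: 2; 4; 4; 1; 3; 4; 0].
  + by exists [:: 1; 1; 2; 2; 3; 0], [:: 2; 4; 4; 1; 3; 3; 4; 0].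
  case/or4P=> /eqP[-> ->].
  + by exists [:: 1; 1; 2; 2; 3; 3; 0], [:: 2; 4; 4; 1; 3; 4; 0].
  + by exists [:: 1; 2; 0], [:: 3; 3; 1; 1; 4; 4; 2; 3; 4; 0].
  + by exists [:: 1; 2; 0], [:: 3; 3; 1; 1; 4; 4; 2; 2; 3; 4; 0].
  + by exists [:: 1; 1; 2; 0], [:: 3; 3; 1; 4; 4; 2; 2; 3; 4; 0].
- subst n N.
  have : (a, b) \in [:: (12, 14); (13, 14); (12, 15)].
    by move: a_len b_len; rewrite /trail_length !inE !xpair_eqE; lia.
  rewrite !inE => /or3P[] /eqP[-> ->].
  + by exists [:: 1; 1; 2; 2; 0; 3; 3; 1; 4; 4; 5; 0],
      [:: 4; 2; 3; 4; 6; 6; 1; 5; 2; 6; 3; 5; 6; 0].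
  + by exists [:: 1; 1; 2; 2; 0; 3; 3; 1; 4; 4; 2; 5; 0],
      [:: 4; 3; 2; 6; 6; 1; 5; 5; 3; 6; 4; 5; 6; 0].
  + by exists [:: 1; 1; 2; 2; 0; 3; 3; 1; 4; 4; 5; 0],
      [:: 4; 2; 3; 4; 6; 6; 1; 5; 5; 2; 6; 3; 5; 6; 0].
Qed.

Theorem theorem2p5 (k c2 c3 : nat) (hk : odd k) (hc2 : 0 < c2)
    (hc23 : c2 <= c3) :
  embeddable (petal_graph [:: 1; c2; c3]) (looped_complete k) <->
  3 <= c2 /\ 1 + c2 + c3 <= 'C(k.+1, 2).
Proof.
split=> [emb | [c2_ge3 card_le]].
  split; last first.
    have := embeddable_card_edge emb.
    by rewrite card_looped_complete_edge card_petal_edge /= addn0 addnA.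
  case: emb => f /embedding_looped_complete f_inj.
  case: c2 hc2 hc23 f f_inj => [|[|[|c2]]] // _ _ f f_inj.
  (* Two petals of length 1 are loops with the same end. *)
  - pose c := [:: 1; 1; c3].
    pose loop0 : petal_edge c :=
      @existT 'I_3 _ (@Ordinal 3 0 isT) (@Ordinal 1 0 isT).
    pose loop1 : petal_edge c :=
      @existT 'I_3 _ (@Ordinal 3 1 isT) (@Ordinal 1 0 isT).
    have : loop0 = loop1.
      by apply: f_inj; congr (f @: _); rewrite /= /petal_ends /= !insubF.
    by move/(congr1 (fun e : petal_edge c => val (tag e))).
  (* Both edges of a petal of length 2 have the same two ends. *)
  - pose c := [:: 1; 2; c3].
    pose edge0 : petal_edge c :=
      @existT 'I_3 _ (@Ordinal 3 1 isT) (@Ordinal 2 0 isT).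
    pose edge1 : petal_edge c :=
      @existT 'I_3 _ (@Ordinal 3 1 isT) (@Ordinal 2 1 isT).
    have : edge0 = edge1.
      apply: f_inj; congr (f @: _).
      by rewrite /= /petal_ends /= (@insubF _ _ _ 1) // setUC.
    by move/(congr1 (fun e : petal_edge c => val (tagged e))).
have [n kE] : exists n, k = n.*2.+1.
  by exists k./2; rewrite -[LHS]odd_double_half hk.
have [s [t [size_s size_t st]]] : has_trail_pair k c2 c3.
  rewrite kE; apply: has_trail_pair_le_size; rewrite /trail_length; try lia.
  by move: card_le; rewrite kE bin2 succnK -doubleS -doubleMl doubleK; lia.
have := closed_trails_embeddable (odd_gt0 hk) st.
by rewrite /= size_s size_t.
Qed.
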